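(* Let $M$ and $E$ be two monoids. Then the categories $[M^{\mathrm{op}},\mathcal{S}et]$ and $[E^{\mathrm{op}},\mathcal{S}et]$ are equivalent via mutually inverse equivalence functors $H:[M^{\mathrm{op}},\mathcal{S}et]\to[E^{\mathrm{op}},\mathcal{S}et]$ and $T:[E^{\mathrm{op}},\mathcal{S}et]\to[M^{\mathrm{op}},\mathcal{S}et]$ if and only if there is a cyclic, projective generator $A$ of $[M^{\mathrm{op}},\mathcal{S}et]$ such that $E$ is (up to isomorphism) the endomorphism monoid of $A$, in which case $H\cong H_A$ and $T\cong T_A$ naturally.
   Context: For a monoid $M$, $[M^{\mathrm{op}},\mathcal{S}et]$ is the category of right $M$-acts: sets $X$ with an action $X\times M\to X$ such that $(xm)m'=x(mm')$ and $x1=x$ (the empty act is allowed), with equivariant maps; $[X,X']$ denotes the set of morphisms. An act $A$ is cyclic if $A=aM$ for some $a\in A$. It is projective if it is a projective object (with respect to epimorphisms) of $[M^{\mathrm{op}},\mathcal{S}et]$, and a generator if the functor $[A,-]$ is faithful. For a right $M$-act $A$ with endomorphism monoid $E=[A,A]$, $A$ is an $E$-$M$-biact; $H_A:[M^{\mathrm{op}},\mathcal{S}et]\to[E^{\mathrm{op}},\mathcal{S}et]$ is $H_A(X)=[A,X]$, and $T_A:[E^{\mathrm{op}},\mathcal{S}et]\to[M^{\mathrm{op}},\mathcal{S}et]$ is $T_A(Y)=Y\otimes_E A$ (the quotient of $Y\times A$ by the equivalence relation generated by $(ye,a)\sim(y,ea)$), which is left adjoint to $H_A$. *)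

(* Defs.v *)
From HB Require Import structures.
From mathcomp Require Import all_boot.
From mathcomp Require Import boolp.
From Stdlib Require Import Relation_Operators.

Set Implicit Arguments.
Unset Strict Implicit.
Unset Printing Implicit Defensive.

Local Open Scope group_scope.
Local Open Scope quotient_scope.

Record category := Category {
  obj :> Type;
  hom : obj -> obj -> Type;
  idm : forall X, hom X X;
  comp : forall X Y Z, hom Y Z -> hom X Y -> hom X Z;
  comp_idl : forall X Y (f : hom X Y), comp (idm Y) f = f;
  comp_idr : forall X Y (f : hom X Y), comp f (idm X) = f;
  comp_assoc : forall W X Y Z (h : hom Y Z) (g : hom X Y) (f : hom W X),
    comp h (comp g f) = comp (comp h g) f }.

Arguments hom {c} X Y.
Arguments idm {c} X.
Arguments comp {c X Y Z} g f : rename.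

(* The category Set: sets are types with Leibniz equality. *)
Definition types : category :=
  @Category Type (fun X Y => X -> Y) (fun X => @id X)
    (fun X Y Z (g : Y -> Z) (f : X -> Y) => fun x => g (f x))
    (fun _ _ _ => erefl) (fun _ _ _ => erefl) (fun _ _ _ _ _ _ _ => erefl).

Definition is_iso (C : category) (X Y : C) (f : hom X Y) : Prop :=
  exists g : hom Y X, comp g f = idm X /\ comp f g = idm Y.

Definition epi (C : category) (X Y : C) (p : hom X Y) : Prop :=
  forall (Z : C) (f g : hom Y Z), comp f p = comp g p -> f = g.

Definition projective (C : category) (P : C) : Prop :=
  forall (X Y : C) (p : hom X Y), epi p ->
  forall f : hom P Y, exists g : hom P X, comp p g = f.

Record functor (C D : category) := Functor {
  fobj :> C -> D;
  fmap : forall X Y : C, hom X Y -> hom (fobj X) (fobj Y);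
  fmap_id : forall X : C, fmap (idm X) = idm (fobj X);
  fmap_comp : forall (X Y Z : C) (g : hom Y Z) (f : hom X Y),
    fmap (comp g f) = comp (fmap g) (fmap f) }.

Arguments fmap {C D} F {X Y} f : rename.

Definition id_functor (C : category) : functor C C :=
  @Functor C C id (fun X Y f => f) (fun _ => erefl) (fun _ _ _ _ _ => erefl).

Lemma comp_functor_id (B C D : category) (G : functor C D) (F : functor B C)
    (X : B) : fmap G (fmap F (idm X)) = idm (G (F X)).
Proof. by rewrite !fmap_id. Qed.

Lemma comp_functor_comp (B C D : category) (G : functor C D) (F : functor B C)
    (X Y Z : B) (g : hom Y Z) (f : hom X Y) :
  fmap G (fmap F (comp g f)) = comp (fmap G (fmap F g)) (fmap G (fmap F f)).
Proof. by rewrite !fmap_comp. Qed.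

Definition comp_functor (B C D : category) (G : functor C D) (F : functor B C) :
    functor B D :=
  @Functor B D (fun X => G (F X)) (fun X Y f => fmap G (fmap F f))
    (comp_functor_id G F) (comp_functor_comp G F).

Definition faithful (C D : category) (F : functor C D) : Prop :=
  forall X Y : C, injective (fun f : hom X Y => fmap F f).

Definition nat_iso (C D : category) (F G : functor C D) : Prop :=
  exists eta : forall X : C, hom (F X) (G X),
    (forall (X Y : C) (f : hom X Y),
       comp (eta Y) (fmap F f) = comp (fmap G f) (eta X)) /\
    (forall X : C, is_iso (eta X)).

Definition mutually_inverse_equivalences (C D : category)
    (H : functor C D) (T : functor D C) : Prop :=
  nat_iso (comp_functor T H) (id_functor C) /\
  nat_iso (comp_functor H T) (id_functor D).

Definition hom_functor (C : category) (A : C) : functor C types :=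
  @Functor C types (fun X => hom A X) (fun X Y f => fun u => comp f u)
    (fun X => funext (fun u => comp_idl u))
    (fun X Y Z g f => funext (fun u => esym (comp_assoc g f u))).

Definition generator (C : category) (A : C) : Prop := faithful (hom_functor A).

Definition endo (C : category) (A : C) : Type := hom A A.

HB.instance Definition _ (C : category) (A : C) :=
  Choice.copy (endo A) {classic (hom A A)}.

Definition endo_mul (C : category) (A : C) (e e' : endo A) : endo A :=
  comp e e'.

HB.instance Definition _ (C : category) (A : C) :=
  isMonoid.Build (endo A) (mul := @endo_mul C A) (one := idm A)
    (fun e e' e'' => comp_assoc e e' e'')
    (fun e => comp_idl e) (fun e => comp_idr e).

Record act (M : monoidType) := Act {
  act_sort :> Type;
  actr : act_sort -> M -> act_sort;
  actrM : forall x m m', actr (actr x m) m' = actr x (m * m');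
  actr1 : forall x, actr x 1 = x }.

Arguments actr {M a} x m.

Record act_hom (M : monoidType) (X Y : act M) := ActHom {
  act_hom_fun :> X -> Y;
  act_homE : forall x m, act_hom_fun (actr x m) = actr (act_hom_fun x) m }.

Lemma act_hom_ext (M : monoidType) (X Y : act M) (f g : act_hom X Y) :
  f =1 g -> f = g.
Proof.
case: f g => f fE [g gE] /= fg; have {}fg : f = g by exact: funext.
by rewrite fg in fE *; rewrite (Prop_irrelevance fE gE).
Qed.

Definition act_id (M : monoidType) (X : act M) : act_hom X X :=
  @ActHom M X X id (fun _ _ => erefl).

Lemma act_comp_subproof (M : monoidType) (X Y Z : act M)
    (g : act_hom Y Z) (f : act_hom X Y) x m :
  g (f (actr x m)) = actr (g (f x)) m.
Proof. by rewrite !act_homE. Qed.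

Definition act_comp (M : monoidType) (X Y Z : act M)
    (g : act_hom Y Z) (f : act_hom X Y) : act_hom X Z :=
  ActHom (act_comp_subproof g f).

Lemma act_comp_idl (M : monoidType) (X Y : act M) (f : act_hom X Y) :
  act_comp (act_id Y) f = f.
Proof. exact: act_hom_ext. Qed.

Lemma act_comp_idr (M : monoidType) (X Y : act M) (f : act_hom X Y) :
  act_comp f (act_id X) = f.
Proof. exact: act_hom_ext. Qed.

Lemma act_comp_assoc (M : monoidType) (W X Y Z : act M)
    (h : act_hom Y Z) (g : act_hom X Y) (f : act_hom W X) :
  act_comp h (act_comp g f) = act_comp (act_comp h g) f.
Proof. exact: act_hom_ext. Qed.

Definition acts (M : monoidType) : category :=
  @Category (act M) (@act_hom M) (@act_id M) (@act_comp M)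
    (@act_comp_idl M) (@act_comp_idr M) (@act_comp_assoc M).

Canonical acts.

Definition cyclic_act (M : monoidType) (A : act M) : Prop :=
  exists a : A, forall x : A, exists m : M, x = actr a m.

Record monoid_iso (K N : monoidType) := MonoidIso {
  iso_fun : UMagmaMorphism.type K N;
  iso_inv : UMagmaMorphism.type N K;
  iso_funK : cancel iso_fun iso_inv;
  iso_invK : cancel iso_inv iso_fun }.

(* Restriction of scalars along phi : K -> N turns an N-act X into a K-act with
   x k = x phi(k).  Along an isomorphism it identifies the two categories of
   acts. *)
Section Restriction.
Variables (K N : monoidType) (phi : UMagmaMorphism.type K N).

Lemma res_actM (X : act N) (x : X) (k k' : K) :
  actr (actr x (phi k)) (phi k') = actr x (phi (k * k')).
Proof. by rewrite actrM gmulfM. Qed.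

Lemma res_act1 (X : act N) (x : X) : actr x (phi 1) = x.
Proof. by rewrite gmulf1 actr1. Qed.

Definition res_act (X : act N) : act K :=
  @Act K X (fun x k => actr x (phi k)) (@res_actM X) (@res_act1 X).

Definition res_hom (X Y : act N) (f : act_hom X Y) :
    act_hom (res_act X) (res_act Y) :=
  @ActHom K (res_act X) (res_act Y) f (fun x k => act_homE f x (phi k)).

Lemma res_hom_id (X : act N) : res_hom (act_id X) = act_id (res_act X).
Proof. exact: act_hom_ext. Qed.

Lemma res_hom_comp (X Y Z : act N) (g : act_hom Y Z) (f : act_hom X Y) :
  res_hom (act_comp g f) = act_comp (res_hom g) (res_hom f).
Proof. exact: act_hom_ext. Qed.

Definition restriction : functor (acts N) (acts K) :=
  @Functor (acts N) (acts K) res_act res_hom res_hom_id res_hom_comp.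

End Restriction.

Section HomFunctor.
Variables (M : monoidType) (A : acts M).

(* [A, X] with the right action (f e)(a) = f (e a). *)
Definition hom_act (X : acts M) : act (endo A) :=
  @Act (endo A) (hom A X) (fun f e => comp f e)
    (fun f e e' => esym (comp_assoc f e e')) (fun f => comp_idr f).

Definition hom_act_map (X Y : acts M) (g : hom X Y) :
    act_hom (hom_act X) (hom_act Y) :=
  @ActHom (endo A) (hom_act X) (hom_act Y) (fun f => comp g f)
    (fun f e => comp_assoc g f e).

Lemma hom_act_map_id (X : acts M) :
  hom_act_map (idm X) = act_id (hom_act X).
Proof. by apply: act_hom_ext => f; apply: (@comp_idl (acts M)). Qed.

Lemma hom_act_map_comp (X Y Z : acts M) (g : hom Y Z) (f : hom X Y) :
  hom_act_map (comp g f) = act_comp (hom_act_map g) (hom_act_map f).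
Proof.
by apply: act_hom_ext => u; rewrite /= -(@comp_assoc (acts M)).
Qed.

Definition H_functor : functor (acts M) (acts (endo A)) :=
  @Functor (acts M) (acts (endo A)) hom_act hom_act_map
    hom_act_map_id hom_act_map_comp.

End HomFunctor.

Section TensorFunctor.
Variables (M : monoidType) (A : acts M).

Section Objects.
Variable Y : acts (endo A).

(* The quotient of Y * A by the equivalence relation generated by
   (y e, a) ~ (y, e a), where e a is the value at a of the endomorphism e. *)
Definition tensor_step (p q : Y * A) : Prop :=
  exists (y : Y) (e : act_hom A A) (a : A), p = (actr y e, a) /\ q = (y, e a).

Definition tensor_rel : rel {classic Y * A} :=
  fun p q => `[< clos_refl_sym_trans (Y * A) tensor_step p q >].

Lemma tensor_rel_refl : reflexive tensor_rel.
Proof. by move=> p; apply/asboolP/rst_refl. Qed.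

Lemma tensor_rel_sym : symmetric tensor_rel.
Proof.
by move=> p q; apply: asbool_equiv_eq; split; apply: rst_sym.
Qed.

Lemma tensor_rel_trans : transitive tensor_rel.
Proof.
by move=> q p r /asboolP pq /asboolP qr; apply/asboolP; apply: rst_trans pq qr.
Qed.

Canonical tensor_equiv :=
  EquivRel tensor_rel tensor_rel_refl tensor_rel_sym tensor_rel_trans.

Definition tensor : Type := {eq_quot tensor_equiv}.

Definition tens (y : Y) (a : A) : tensor :=
  \pi_{eq_quot tensor_equiv} ((y, a) : {classic Y * A}).

Lemma tensP (t : tensor) : exists y a, t = tens y a.
Proof.
by elim/quotW: t => -[y a]; exists y, a.
Qed.

(* Universal property: a function on pairs that identifies (ye, a) and (y, ea)
   factors through the quotient. *)
Definition tensor_lift (Z : Type) (f : Y -> A -> Z) (t : tensor) : Z :=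
  let p : Y * A := repr (t : {eq_quot tensor_equiv}) in f p.1 p.2.

Lemma tensor_liftE (Z : Type) (f : Y -> A -> Z) :
  (forall (y : Y) (e : act_hom A A) (a : A), f (actr y e) a = f y (e a)) ->
  forall y a, tensor_lift f (tens y a) = f y a.
Proof.
move=> fE y a; rewrite /tensor_lift /tens.
have /eqmodP/asboolP := reprK (\pi_{eq_quot tensor_equiv} ((y, a) : {classic Y * A})).
move: (repr _) => p; rewrite -[f y a]/((fun q : Y * A => f q.1 q.2) (y, a)).
by elim=> {p} [p q [y' [e [a' [-> ->]]]]|p|p q _ ->|p q r _ -> _ ->] /=.
Qed.

Lemma tens_bal (y : Y) (e : act_hom A A) (a : A) :
  tens (actr y e) a = tens y (e a).
Proof. by apply/eqmodP/asboolP/rst_step; exists y, e, a. Qed.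

Definition tensor_actr (t : tensor) (m : M) : tensor :=
  tensor_lift (fun y a => tens y (actr a m)) t.

Lemma tensor_actrE y a m : tensor_actr (tens y a) m = tens y (actr a m).
Proof.
by rewrite /tensor_actr tensor_liftE // => y' e a'; rewrite tens_bal act_homE.
Qed.

Lemma tensor_actrM t m m' :
  tensor_actr (tensor_actr t m) m' = tensor_actr t (m * m').
Proof. by have [y [a ->]] := tensP t; rewrite !tensor_actrE actrM. Qed.

Lemma tensor_actr1 t : tensor_actr t 1 = t.
Proof. by have [y [a ->]] := tensP t; rewrite tensor_actrE actr1. Qed.

Definition tensor_act : act M := Act tensor_actrM tensor_actr1.

End Objects.

Definition tensor_fun (Y Y' : act (endo A)) (g : act_hom Y Y') (t : tensor Y) :
    tensor Y' :=
  tensor_lift (fun y a => tens (g y) a) t.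

Lemma tensor_funE (Y Y' : act (endo A)) (g : act_hom Y Y') y a :
  tensor_fun g (tens y a) = tens (g y) a.
Proof.
by rewrite /tensor_fun tensor_liftE // => y' e a'; rewrite act_homE tens_bal.
Qed.

Lemma tensor_fun_actr (Y Y' : act (endo A)) (g : act_hom Y Y')
    (t : tensor_act Y) (m : M) :
  tensor_fun g (actr t m) = actr (tensor_fun g t : tensor_act Y') m.
Proof.
have [y [a ->]] := tensP t.
by rewrite /actr /= tensor_actrE !tensor_funE tensor_actrE.
Qed.

Definition tensor_map (Y Y' : act (endo A)) (g : act_hom Y Y') :
    act_hom (tensor_act Y) (tensor_act Y') :=
  @ActHom M (tensor_act Y) (tensor_act Y') (tensor_fun g) (tensor_fun_actr g).

Lemma tensor_map_id (Y : act (endo A)) :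
  tensor_map (act_id Y) = act_id (tensor_act Y).
Proof.
by apply: act_hom_ext => t; have [y [a ->]] := tensP t; rewrite /= tensor_funE.
Qed.

Lemma tensor_map_comp (X Y Z : act (endo A)) (g : act_hom Y Z)
    (f : act_hom X Y) :
  tensor_map (act_comp g f) = act_comp (tensor_map g) (tensor_map f).
Proof.
apply: act_hom_ext => t; have [y [a ->]] := tensP t.
by rewrite /= !tensor_funE.
Qed.

Definition T_functor : functor (acts (endo A)) (acts M) :=
  @Functor (acts (endo A)) (acts M) tensor_act tensor_map
    tensor_map_id tensor_map_comp.

End TensorFunctor.

(* Main.v *)
(* Given an equivalence (H, T), take A := T E, the image of the regular act E.
   The orbit maps M -> A are jointly surjective, hence jointly epi; so are their
   images under H, and since HA is isomorphic to the cyclic act E, one of these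
   images splits.  Thus A is a retract of M, i.e. cyclic and projective.
   Faithfulness of H makes A a generator, and HX = [E, HX] = [TE, X] = [A, X].
   T is then T_A because inverses of naturally isomorphic equivalences agree.

   Conversely, let A = aM be projective and a generator.  Projectivity gives
   s : A -> M with a s(x) = x, and generation gives f : A -> M with f(b) = 1.
   In [A, X] (x) A every u (x) x equals (t |-> u(x) f(t)) (x) b, so evaluation
   is injective; the map y (x) x |-> y (t |-> x s(t)) sends y (x) a to y, so the
   unit Y -> [A, Y (x) A] is injective, and it is surjective because g : A ->
   Y (x) A with g(a) = y (x) t satisfies g(x) = y (x) (t s(x)). *)
Require Import Defs.
From mathcomp Require Import all_boot.
From HB Require Import structures.
From mathcomp Require Import boolp.
Import Defs.

Set Implicit Arguments.
Unset Strict Implicit.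
Unset Printing Implicit Defensive.

Local Open Scope group_scope.

(** * Calculus of natural isomorphisms and of equivalences of categories *)

Section NaturalIsomorphisms.

Lemma is_iso_comp (C : category) (X Y Z : C) (g : hom Y Z) (f : hom X Y) :
  is_iso g -> is_iso f -> is_iso (comp g f).
Proof.
move=> [g' [g'g gg']] [f' [f'f ff']]; exists (comp f' g'); split.
  by rewrite comp_assoc -(comp_assoc f' g' g) g'g comp_idr.
by rewrite comp_assoc -(comp_assoc g f f') ff' comp_idr.
Qed.

Lemma is_iso_monic (C : category) (W X Y : C) (p : hom X Y) (f g : hom W X) :
  is_iso p -> comp p f = comp p g -> f = g.
Proof.
by move=> [q [qp _]] /(congr1 (comp q)); rewrite !comp_assoc qp !comp_idl.
Qed.

Lemma is_iso_epi (C : category) (X Y : C) (p : hom X Y) : is_iso p -> epi p.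
Proof.
move=> [q [_ pq]] Z f g /(congr1 (fun h => comp h q)).
by rewrite -!comp_assoc pq !comp_idr.
Qed.

Lemma fmap_iso (C D : category) (F : functor C D) (X Y : C) (f : hom X Y) :
  is_iso f -> is_iso (fmap F f).
Proof.
by move=> [g [gf fg]]; exists (fmap F g); rewrite -!fmap_comp gf fg !fmap_id.
Qed.

Lemma nat_iso_refl (C D : category) (F : functor C D) : nat_iso F F.
Proof.
exists (fun X => idm (F X)); split=> [X Y f|X].
  by rewrite comp_idl comp_idr.
by exists (idm (F X)); rewrite comp_idl.
Qed.

Lemma nat_iso_sym (C D : category) (F G : functor C D) :
  nat_iso F G -> nat_iso G F.
Proof.
move=> [eta [etaN etaI]].
(* [is_iso] only asserts existence, so the inverse components are chosen here. *)
have inv X := cid (etaI X).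
exists (fun X => sval (inv X)); split=> [X Y f|X]; last first.
  by case: (inv X) => g /= [gf fg]; exists (eta X).
case: (inv X) (inv Y) => g /= [gf fg] [g' /= [gf' fg']].
apply: (is_iso_epi (etaI X)).
by rewrite -!comp_assoc gf -etaN comp_assoc gf' comp_idl comp_idr.
Qed.

Lemma nat_iso_trans (C D : category) (G F K : functor C D) :
  nat_iso F G -> nat_iso G K -> nat_iso F K.
Proof.
move=> [eta [etaN etaI]] [th [thN thI]].
exists (fun X => comp (th X) (eta X)); split=> [X Y f|X].
  by rewrite -comp_assoc etaN comp_assoc thN comp_assoc.
exact: is_iso_comp.
Qed.

Lemma nat_iso_comp (B C D : category) (G G' : functor C D)
    (F F' : functor B C) :
  nat_iso G G' -> nat_iso F F' ->
  nat_iso (comp_functor G F) (comp_functor G' F').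
Proof.
move=> [th [thN thI]] [eta [etaN etaI]].
exists (fun X => comp (th (F' X)) (fmap G (eta X))); split=> [X Y f|X] /=.
  by rewrite -comp_assoc -fmap_comp etaN fmap_comp comp_assoc thN comp_assoc.
by apply: is_iso_comp => //; apply: fmap_iso.
Qed.

Lemma mutually_inverse_nat_iso (C D : category) (H H' : functor C D)
    (T T' : functor D C) :
  nat_iso H H' -> nat_iso T T' ->
  mutually_inverse_equivalences H' T' -> mutually_inverse_equivalences H T.
Proof.
move=> HH' TT' [TH HT].
split; [apply: nat_iso_trans TH|apply: nat_iso_trans HT]; exact: nat_iso_comp.
Qed.

Lemma mutually_inverse_comp (B C D : category) (H : functor C D)
    (T : functor D C) (H' : functor B C) (T' : functor C B) :
  mutually_inverse_equivalences H T -> mutually_inverse_equivalences H' T' ->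
  mutually_inverse_equivalences (comp_functor H H') (comp_functor T' T).
Proof.
move=> [TH HT] [TH' HT']; split.
  apply: nat_iso_trans TH'.
  exact: (nat_iso_comp (nat_iso_refl T') (nat_iso_comp TH (nat_iso_refl H'))).
apply: nat_iso_trans HT.
exact: (nat_iso_comp (nat_iso_refl H) (nat_iso_comp HT' (nat_iso_refl T))).
Qed.

(** The chain is T ~ T (H T') = (T H) T' ~ T'. *)
Lemma mutually_inverse_unique (C D : category) (H : functor C D)
    (T T' : functor D C) :
  mutually_inverse_equivalences H T -> mutually_inverse_equivalences H T' ->
  nat_iso T T'.
Proof.
move=> [TH _] [_ HT'].
apply: (@nat_iso_trans _ _ (comp_functor T (comp_functor H T'))).
  by have := nat_iso_sym (nat_iso_comp (nat_iso_refl T) HT').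
by have := nat_iso_comp TH (nat_iso_refl T').
Qed.

(* Restates the naturality data with the composite and identity functors
   unfolded, so that the types of the components are syntactically usable by
   rewriting. *)
Lemma left_inverse_transformation (C D : category) (F : functor C D)
    (G : functor D C) :
  nat_iso (comp_functor G F) (id_functor C) ->
  exists eps : forall X : C, hom (G (F X)) X,
    (forall (X Y : C) (f : hom X Y),
       comp (eps Y) (fmap G (fmap F f)) = comp f (eps X)) /\
    (forall X : C, is_iso (eps X)).
Proof. by []. Qed.

(** By naturality, [f] is recovered from [fmap G (fmap F f)] through the invertible components
    [eps]. *)
Lemma left_inverse_faithful (C D : category) (F : functor C D)
    (G : functor D C) :
  nat_iso (comp_functor G F) (id_functor C) -> faithful F.
Proof.
move=> /left_inverse_transformation [eps [epsN epsI]] X Y f g fg.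
by apply: (is_iso_epi (epsI X)); rewrite -!epsN fg.
Qed.

(** Conjugating [fmap H f] by [eta] gives the preimage; faithfulness of [H] reduces [fmap T g = f]
    to naturality of [eta]. *)
Lemma mutually_inverse_full (C D : category) (H : functor C D)
    (T : functor D C) :
  mutually_inverse_equivalences H T ->
  forall (X Y : D) (f : hom (T X) (T Y)), exists g, fmap T g = f.
Proof.
move=> [TH /left_inverse_transformation [eta [etaN etaI]]] X Y f.
have [eta' [etaV etaK]] := etaI X.
exists (comp (eta Y) (comp (fmap H f) eta')).
apply: (left_inverse_faithful TH); apply: (is_iso_monic (etaI Y)).
by rewrite etaN -!comp_assoc etaV comp_idr.
Qed.

End NaturalIsomorphisms.

(** * Acts over a monoid: regular act, epimorphisms, generators, cyclic projectives *)

Section Acts.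
Variable M : monoidType.

Definition regular_act : act M :=
  @Act M M (fun x m => x * m) (fun x m m' => esym (mulgA x m m')) (@mulg1 M).

(** The Yoneda correspondence: elements of [X] are the morphisms from the regular act, by evaluation
    at 1. *)
Definition orbit_hom (X : act M) (x : X) : act_hom regular_act X :=
  @ActHom M regular_act X (fun m => actr x m)
    (fun m m' => esym (actrM x m m')).

Lemma orbit_hom1 (X : act M) (x : X) : orbit_hom x 1 = x.
Proof. exact: actr1. Qed.

Lemma comp_orbit_hom (X Y : acts M) (f : hom X Y) (x : X) :
  comp f (orbit_hom x : hom (regular_act : acts M) X) = orbit_hom (f x).
Proof. by apply: act_hom_ext => m; apply: act_homE. Qed.

Lemma orbit_homK (X : act M) (f : act_hom regular_act X) :
  orbit_hom (f 1) = f.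
Proof. by apply: act_hom_ext => m /=; rewrite -act_homE /= mul1g. Qed.

Lemma bijective_act_iso (X Y : acts M) (f : hom X Y) :
  injective f -> (forall y, exists x, f x = y) -> is_iso f.
Proof.
move=> f_inj f_surj; have inv y := cid (f_surj y).
have gE y m : sval (inv (actr y m)) = actr (sval (inv y)) m.
  by apply: f_inj; rewrite act_homE (svalP (inv _)) (svalP (inv _)).
exists (ActHom gE); split; apply: act_hom_ext => x /=.
  by apply: f_inj; apply: svalP (inv _).
exact: svalP (inv x).
Qed.

Lemma surjective_act_epi (X Y : acts M) (p : hom X Y) :
  (forall y, exists x, p x = y) -> epi p.
Proof.
move=> p_surj Z f g fg; apply: act_hom_ext => y; have [x <-] := p_surj y.
exact: (congr1 (fun h : act_hom X Z => h x) fg).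
Qed.

(* Plays the role of a subobject classifier: it separates a subact from the
   whole act, without having to form a pushout or a quotient. *)
Definition pred_act : act M :=
  @Act M (M -> Prop) (fun P m n => P (m * n))
    (fun P m m' => funext (fun n => congr1 P (mulgA m m' n)))
    (fun P => funext (fun n => congr1 P (mul1g n))).

Lemma char_hom_subproof (X : act M) (I : X -> Prop) x m :
  ((fun n => I (actr (actr x m) n)) : pred_act)
    = actr ((fun n => I (actr x n)) : pred_act) m.
Proof. by apply: funext => n; rewrite actrM. Qed.

Definition char_hom (X : act M) (I : X -> Prop) : act_hom X pred_act :=
  @ActHom M X pred_act (fun x n => I (actr x n)) (char_hom_subproof I).

Lemma char_hom_true (X : act M) (I : X -> Prop) :
  char_hom I = char_hom (fun=> True) -> forall x, I x.
Proof.
move=> /(congr1 (fun h : act_hom X pred_act => h)) II x.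
have := congr1 (fun h : act_hom X pred_act => h x 1) II.
by rewrite /= actr1 => ->.
Qed.

Lemma char_hom_comp (X Y : acts M) (f : hom X Y) (I : Y -> Prop) :
  (forall x, I (f x)) -> comp (char_hom I : hom Y (pred_act : acts M)) f
    = comp (char_hom (fun=> True) : hom Y (pred_act : acts M)) f.
Proof.
move=> If; apply: act_hom_ext => x; apply: funext => m /=.
by apply: propext; split=> // _; rewrite -act_homE.
Qed.

(** The characteristic map of the image of [p] and the constantly true one agree after [p], hence
    are equal. *)
Lemma epi_act_surjective (X Y : acts M) (p : hom X Y) :
  epi p -> forall y, exists x, p x = y.
Proof.
move=> p_epi; apply: char_hom_true; apply: p_epi.
by apply: char_hom_comp => x; exists x.
Qed.

(** Let I be the union of the images of all morphisms from [A] to the regular act. Its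
    characteristic map and the true one agree along each of them, so the generator property makes I
    everything, and 1 lies in I. *)
Lemma generator_unit (A : acts M) :
  generator A -> exists (f : act_hom A regular_act) (b : A), f b = 1.
Proof.
move=> genA.
suff: forall m, exists (f : act_hom A regular_act) (b : A), f b = m by apply.
apply: (@char_hom_true regular_act).
apply: (genA (regular_act : acts M)); apply: funext => f.
by apply: char_hom_comp => b; exists f, b.
Qed.

(** The orbit map of [a] is surjective, hence epi, and lifting the identity of [A] splits it. *)
Lemma cyclic_projective_section (A : acts M) (a : A) :
  (forall x : A, exists m, x = actr a m) -> projective A ->
  exists s : act_hom A regular_act, forall x, actr a (s x) = x.
Proof.
move=> cycA projA.
have [|s sE] := projA (regular_act : acts M) A (orbit_hom a) _ (idm A).
  by apply: surjective_act_epi => x; have [m ->] := cycA x; exists m.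
by exists s => x; apply: (congr1 (fun h : act_hom A A => h x) sE).
Qed.

Lemma regular_retract_cyclic_projective (A : acts M)
    (r : hom (regular_act : acts M) A) (s : hom A (regular_act : acts M)) :
  comp r s = idm A -> cyclic_act A /\ projective A.
Proof.
move=> rs.
have rsK x : r (s x) = x by apply: (congr1 (fun h : act_hom A A => h x) rs).
split=> [|X Y p p_epi f].
  by exists (r 1) => x; exists (s x); rewrite -act_homE /= mul1g rsK.
(* A lift is fixed by one choice: a preimage of the image of the cyclic generator [r 1]. *)
have [x px] := epi_act_surjective p_epi (f (r 1)).
exists (comp (orbit_hom x : hom (regular_act : acts M) X) s).
apply: act_hom_ext => y /=.
by rewrite act_homE px -!act_homE /= mul1g rsK.
Qed.

End Acts.

(** * Evaluation and unit are isomorphisms for a cyclic projective generator *)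

Section TensorHomEquivalence.
Variables (M : monoidType) (A : acts M).
Variables (a : A) (s : act_hom A (regular_act M)).
Hypothesis actr_s : forall x, actr a (s x) = x.
Variables (b : A) (f : act_hom A (regular_act M)).
Hypothesis f_b : f b = 1.

Definition tensor_eval (X : acts M) : tensor (hom_act A X) -> X :=
  tensor_lift (Y := hom_act A X) (fun (u : act_hom A X) x => u x).

Lemma tensor_evalE (X : acts M) (u : act_hom A X) x :
  tensor_eval (tens (Y := hom_act A X) u x) = u x.
Proof. exact: tensor_liftE. Qed.

Lemma tensor_eval_actr (X : acts M) (t : tensor_act (hom_act A X)) m :
  tensor_eval (actr t m) = actr (tensor_eval t) m.
Proof.
by have [u [x ->]] := tensP t; rewrite /= tensor_actrE !tensor_evalE act_homE.
Qed.

Definition tensor_eval_hom (X : acts M) :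
    act_hom (tensor_act (hom_act A X)) X :=
  ActHom (@tensor_eval_actr X).

Lemma tensor_eval_inj (X : acts M) : injective (@tensor_eval X).
Proof.
(* The right-hand side depends on [u] and [x] only through [u x], so it is a normal form for tensors
   with a given evaluation. *)
suff canon (u : act_hom A X) x : tens (Y := hom_act A X) u x =
    tens (Y := hom_act A X) (act_comp (orbit_hom (u x)) f) b.
  move=> t t'; have [u [x ->]] := tensP t; have [u' [x' ->]] := tensP t'.
  by rewrite !tensor_evalE (canon u) (canon u') => ->.
rewrite -comp_orbit_hom.
(* As f(b) = 1, [x] is the value at [b] of the endomorphism t |-> x f(t), which then crosses the
   tensor sign. *)
transitivity (tens (Y := hom_act A X) u (act_comp (orbit_hom x) f b)).
  by rewrite /= f_b actr1.
by rewrite -tens_bal; congr (tens _ _); apply: act_hom_ext.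
Qed.

Lemma tensor_hom_id :
  nat_iso (comp_functor (T_functor A) (H_functor A)) (id_functor (acts M)).
Proof.
exists tensor_eval_hom; split=> [X Y g|X].
  apply: act_hom_ext => t; have [u [x ->]] := tensP t.
  by rewrite /= tensor_funE !tensor_evalE.
apply: bijective_act_iso => [|x]; first exact: tensor_eval_inj.
exists (tens (Y := hom_act A X) (act_comp (orbit_hom x) f) b).
by rewrite /= tensor_evalE /= f_b actr1.
Qed.

Definition tens_hom (Y : acts (endo A)) (y : Y) : act_hom A (tensor_act Y) :=
  @ActHom M A (tensor_act Y) (tens y) (fun x m => esym (tensor_actrE y x m)).

Lemma tens_hom_actr (Y : acts (endo A)) (y : Y) (e : endo A) :
  tens_hom (actr y e) = actr (tens_hom y : hom_act A (tensor_act Y)) e.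
Proof. by apply: act_hom_ext => x /=; rewrite tens_bal. Qed.

Definition tens_unit (Y : acts (endo A)) :
    act_hom Y (hom_act A (tensor_act Y)) :=
  @ActHom (endo A) Y (hom_act A (tensor_act Y)) (@tens_hom Y)
    (@tens_hom_actr Y).

Lemma tens_unit_inj (Y : acts (endo A)) : injective (@tens_unit Y).
Proof.
(* [g] is balanced, so it lifts to the tensor product; it sends (y, a) to y because t |-> a s(t) is
   the identity. *)
pose g (y : Y) (x : A) := actr y (act_comp (orbit_hom x) s : endo A).
have gE (y : Y) (e : act_hom A A) x : g (actr y (e : endo A)) x = g y (e x).
  rewrite /g actrM; congr (actr y _).
  by rewrite -comp_orbit_hom; apply: act_hom_ext.
have ga y : g y a = y.
  rewrite /g -[RHS]actr1; congr (actr y _); apply: act_hom_ext => x /=.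
  exact: actr_s.
move=> y y' /(congr1 (fun h : act_hom A (tensor_act Y) => h a)) /= yy'.
by rewrite -(ga y) -(ga y') -!(tensor_liftE gE) yy'.
Qed.

(** Since z = a s(z), [g] is determined by its value [tens y x] at [a]; the preimage is [y] acted on
    by t |-> x s(t). *)
Lemma tens_unit_surj (Y : acts (endo A)) (g : act_hom A (tensor_act Y)) :
  exists y, tens_unit Y y = g.
Proof.
have [y [x ga]] := tensP (g a).
exists (actr y (act_comp (orbit_hom x) s : endo A)).
apply: act_hom_ext => z /=; rewrite tens_bal -[in RHS](actr_s z) act_homE ga.
by rewrite /= tensor_actrE.
Qed.

Lemma hom_tensor_id :
  nat_iso (comp_functor (H_functor A) (T_functor A))
    (id_functor (acts (endo A))).
Proof.
apply: nat_iso_sym; exists tens_unit; split=> [X Y g|X].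
  by apply: act_hom_ext => y; apply: act_hom_ext => x; rewrite /= tensor_funE.
by apply: bijective_act_iso; [apply: tens_unit_inj|apply: tens_unit_surj].
Qed.

End TensorHomEquivalence.

Lemma cyclic_projective_generator_equivalence (M : monoidType) (A : acts M) :
  cyclic_act A -> projective A -> generator A ->
  mutually_inverse_equivalences (H_functor A) (T_functor A).
Proof.
move=> [a cycA] /(cyclic_projective_section cycA) [s sE].
move=> /generator_unit [f [b fb]].
by split; [apply: tensor_hom_id fb|apply: hom_tensor_id sE].
Qed.

(** * Transport of the equivalence along an isomorphism of monoids *)

Lemma restriction_cancel (K N : monoidType) (phi : UMagmaMorphism.type K N)
    (psi : UMagmaMorphism.type N K) :
  cancel psi phi ->
  nat_iso (comp_functor (restriction psi) (restriction phi))
    (id_functor (acts N)).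
Proof.
move=> psiK.
have resE (X : act N) (x : X) n :
    actr (x : res_act psi (res_act phi X)) n = actr x n.
  by rewrite /= psiK.
exists (fun X => @ActHom N (res_act psi (res_act phi X)) X id (resE X)).
split=> [X Y g|X]; first exact: act_hom_ext.
by apply: bijective_act_iso => // x; exists x.
Qed.

Lemma restriction_equivalence (K N : monoidType) (phi : monoid_iso K N) :
  mutually_inverse_equivalences (restriction (iso_fun phi))
    (restriction (iso_inv phi)).
Proof.
by split; apply: restriction_cancel; [apply: iso_invK|apply: iso_funK].
Qed.

Lemma hom_tensor_equivalence (M E : monoidType) (A : acts M)
    (phi : monoid_iso E (endo A)) :
  cyclic_act A -> projective A -> generator A ->
  mutually_inverse_equivalences
    (comp_functor (restriction (iso_fun phi)) (H_functor A))
    (comp_functor (T_functor A) (restriction (iso_inv phi))).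
Proof.
move=> cycA projA genA; apply: mutually_inverse_comp.
  exact: restriction_equivalence.
exact: cyclic_projective_generator_equivalence.
Qed.

(** * The image of the regular act under an arbitrary equivalence *)

Section EquivalenceOfActs.
Variables (M E : monoidType).
Variables (H : functor (acts M) (acts E)) (T : functor (acts E) (acts M)).
Hypothesis HT : mutually_inverse_equivalences H T.

Local Notation reg := (regular_act E : acts E).
Local Notation orbit y := (orbit_hom y : hom reg _).

Lemma image_regular_retract :
  exists (r : hom (regular_act M : acts M) (T reg))
    (s : hom (T reg) (regular_act M : acts M)), comp r s = idm (T reg).
Proof.
have [eps [epsN epsI]] := left_inverse_transformation HT.1.
have [eta [_ etaI]] := left_inverse_transformation HT.2.
have T_faithful := left_inverse_faithful HT.2.
have [eta1 [eta1K etaK]] := etaI reg.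
have [eps1 [eps1K epsK]] := epsI (T reg).
have eps1_iso : is_iso eps1 by exists (eps (T reg)).
pose u (x : T reg) : hom (regular_act M : acts M) (T reg) := orbit_hom x.
have epsV x : fmap T (fmap H (u x)) = comp (comp eps1 (u x)) (eps _).
  apply: (is_iso_monic (epsI (T reg))).
  by rewrite !comp_assoc epsK comp_idl; apply: epsN.
(* The maps u x are jointly surjective, hence so are the maps H (u x). *)
have hit (z : H (T reg)) : exists x y, fmap H (u x) y = z.
  move: z; apply: char_hom_true; apply: T_faithful.
  apply: (is_iso_epi eps1_iso).
  set P := fmap T _; set Q := fmap T _.
  (* By [epsV], precomposing with [eps] turns both sides into [T] of a composite with
     [fmap H (u x)], whose values satisfy the predicate. *)
  have PQ x : comp (comp P eps1) (u x) = comp (comp Q eps1) (u x).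
    apply: (is_iso_epi (epsI _)).
    rewrite -!comp_assoc (comp_assoc eps1) -epsV -!fmap_comp.
    by rewrite char_hom_comp // => y; exists x, y.
  apply: act_hom_ext => x; rewrite -(orbit_hom1 x).
  exact: (congr1 (fun h : act_hom (regular_act M) _ => h (1 : M)) (PQ x)).
(* A morphism from the regular act is determined at 1, so hitting [eta1 1] factors all of [eta1]
   through one [fmap H (u x)]. *)
have [x [y Hy]] := hit (eta1 (1 : E)).
have split_eta1 : comp (fmap H (u x)) (orbit y) = eta1.
  by rewrite comp_orbit_hom Hy; apply: orbit_homK.
exists (comp (fmap T (eta reg)) (comp eps1 (u x))).
exists (comp (eps _) (fmap T (orbit y))).
rewrite -!comp_assoc (comp_assoc (u x)) (comp_assoc eps1) (comp_assoc eps1).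
rewrite -epsV -fmap_comp split_eta1 -fmap_comp.
by rewrite etaK fmap_id.
Qed.

(** Elements of [H X] are maps [reg -> H X], which [T] followed by [eps] turns into maps
    [T reg -> X]; there [f] and [g] agree by assumption. *)
Lemma image_regular_generator : generator (T reg).
Proof.
have [eps [epsN epsI]] := left_inverse_transformation HT.1.
move=> X Y f g fg; apply: (left_inverse_faithful HT.1).
apply: act_hom_ext => z.
suff : comp (fmap H f) (orbit z) = comp (fmap H g) (orbit z).
  move=> /(congr1 (fun h : act_hom reg (H Y) => h 1)) /=.
  by rewrite actr1.
apply: (left_inverse_faithful HT.2); rewrite !fmap_comp.
apply: (is_iso_monic (epsI Y)); rewrite !comp_assoc.
rewrite !epsN -!comp_assoc.
exact: (congr1 (fun h => h (comp (eps X) (fmap T (orbit z)))) fg).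
Qed.

(** [orbit e] is left multiplication by [e]. Such maps are all the endomorphisms of the right act
    [E], and [T] is full and faithful, so [E] is identified with [endo (T reg)]. *)
Definition translation (e : E) : endo (T reg) :=
  fmap T (orbit (e : regular_act E)).

Lemma translation_morphism : monoid_morphism translation.
Proof.
split=> [|e e'].
  rewrite /translation -[RHS]fmap_id; congr (fmap T _).
  exact: (orbit_homK (act_id reg)).
rewrite /translation [RHS]/(_ * _) /= /endo_mul -fmap_comp comp_orbit_hom.
by [].
Qed.

HB.instance Definition _ :=
  isUMagmaMorphism.Build E (endo (T reg)) translation translation_morphism.

Lemma translation_inj : injective translation.
Proof.
move=> e e' /(left_inverse_faithful HT.2).
by move=> /(congr1 (fun h : act_hom reg reg => h 1)); rewrite /= !mulg1.
Qed.

Lemma translation_surj (f : endo (T reg)) : exists e, translation e = f.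
Proof.
have [g <-] := mutually_inverse_full HT f; exists (g (1 : E)).
by rewrite /translation; congr (fmap T _); apply: orbit_homK.
Qed.

Definition translation_inv (f : endo (T reg)) : E :=
  sval (cid (translation_surj f)).

Lemma translation_invK : cancel translation_inv translation.
Proof. by move=> f; apply: svalP (cid (translation_surj f)). Qed.

Lemma translationK : cancel translation translation_inv.
Proof. by move=> e; apply: translation_inj; rewrite translation_invK. Qed.

Lemma translation_inv_morphism : monoid_morphism translation_inv.
Proof.
split=> [|f g]; apply: translation_inj.
  by rewrite translation_invK gmulf1.
by rewrite translation_morphism.2 !translation_invK.
Qed.

HB.instance Definition _ :=
  isUMagmaMorphism.Build (endo (T reg)) E translation_inv
    translation_inv_morphism.

Definition translation_iso : monoid_iso E (endo (T reg)) :=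
  @MonoidIso E (endo (T reg)) translation translation_inv
    translationK translation_invK.

Lemma equivalence_hom_iso :
  nat_iso H (comp_functor (restriction (iso_fun translation_iso))
    (H_functor (T reg))).
Proof.
have [eps [epsN epsI]] := left_inverse_transformation HT.1.
pose G := comp_functor (restriction (iso_fun translation_iso))
  (H_functor (T reg)).
(* The composite of the bijections H X = [E, H X] = [T E, T H X] = [T E, X]. *)
pose th X (z : H X) : G X := comp (eps X) (fmap T (orbit z)).
have thE X (z : H X) e : th X (actr z e) = actr (th X z) e.
  rewrite /th /= -act_comp_assoc; congr (act_comp _ _).
  rewrite [RHS](esym (fmap_comp T _ _)); congr (fmap T _).
  by rewrite comp_orbit_hom.
exists (fun X => ActHom (thE X)); split=> [X Y f|X].
  apply: act_hom_ext => z /=; rewrite /th -comp_orbit_hom fmap_comp.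
  by rewrite [LHS](comp_assoc (eps Y)) epsN -[LHS]comp_assoc.
apply: bijective_act_iso => [z z'|f] /=.
  move=> /(is_iso_monic (epsI X)) /(left_inverse_faithful HT.2).
  move=> /(congr1 (fun h : act_hom reg (H X) => h 1)).
  by rewrite /= !actr1.
have [eps1 [_ epsK]] := epsI X.
have [g gE] := mutually_inverse_full HT (comp eps1 f : hom (T reg) (T (H X))).
exists (g (1 : E)); rewrite /th.
have -> : orbit (g (1 : E)) = g by apply: orbit_homK.
by rewrite gE comp_assoc epsK comp_idl.
Qed.

End EquivalenceOfActs.

(** * Equivalences correspond to cyclic projective generators *)

Lemma equivalence_progenerator (M E : monoidType)
    (H : functor (acts M) (acts E)) (T : functor (acts E) (acts M)) :
  mutually_inverse_equivalences H T ->
  exists A : acts M,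
    [/\ cyclic_act A, projective A & generator A] /\
    exists phi : monoid_iso E (endo A),
      nat_iso H (comp_functor (restriction (iso_fun phi)) (H_functor A)) /\
      nat_iso T (comp_functor (T_functor A) (restriction (iso_inv phi))).
Proof.
move=> HT; exists (T (regular_act E)).
have [r [s rs]] := image_regular_retract HT.
have [cycA projA] := regular_retract_cyclic_projective rs.
have genA := image_regular_generator HT.
split=> //; exists (translation_iso HT).
have isoH := equivalence_hom_iso HT; split=> //.
(* It remains to see that the transported tensor functor is also inverse to [H], which [isoH]
   reduces to the transported hom functor. *)
apply: (mutually_inverse_unique HT).
apply: mutually_inverse_nat_iso isoH (nat_iso_refl _) _.
exact: hom_tensor_equivalence.
Qed.

Lemma progenerator_equivalence (M E : monoidType)
    (H : functor (acts M) (acts E)) (T : functor (acts E) (acts M))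
    (A : acts M) (phi : monoid_iso E (endo A)) :
  [/\ cyclic_act A, projective A & generator A] ->
  nat_iso H (comp_functor (restriction (iso_fun phi)) (H_functor A)) ->
  nat_iso T (comp_functor (T_functor A) (restriction (iso_inv phi))) ->
  mutually_inverse_equivalences H T.
Proof.
move=> [cycA projA genA] isoH isoT; apply: mutually_inverse_nat_iso isoH isoT _.
exact: hom_tensor_equivalence.
Qed.

Theorem theorem5p7 (M E : monoidType) :
  ((exists (H : functor (acts M) (acts E)) (T : functor (acts E) (acts M)),
      mutually_inverse_equivalences H T)
   <->
   (exists A : acts M,
      [/\ cyclic_act A, projective A & generator A] /\
      inhabited (monoid_iso E (endo A))))
  /\
  (forall (H : functor (acts M) (acts E)) (T : functor (acts E) (acts M)),
     mutually_inverse_equivalences H T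
     <->
     exists A : acts M,
       [/\ cyclic_act A, projective A & generator A] /\
       exists phi : monoid_iso E (endo A),
         nat_iso H (comp_functor (restriction (iso_fun phi)) (H_functor A)) /\
         nat_iso T (comp_functor (T_functor A) (restriction (iso_inv phi)))).
Proof.
split; last first.
  move=> H T; split; first exact: equivalence_progenerator.
  move=> [A [progA [phi [isoH isoT]]]].
  exact: progenerator_equivalence progA isoH isoT.
split=> [[H [T /equivalence_progenerator [A [progA [phi _]]]]]|].
  by exists A; split=> //; exists.
move=> [A [progA [phi]]].
exists (comp_functor (restriction (iso_fun phi)) (H_functor A)).
exists (comp_functor (T_functor A) (restriction (iso_inv phi))).
exact: progenerator_equivalence progA (nat_iso_refl _) (nat_iso_refl _).
Qed.
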